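(* Let $S$ be an infinite discrete semigroup, let $L$ and $R$ be a minimal left ideal and a minimal right ideal of $\beta S$, respectively, and let $p \in L \cap R$. Then $$L \cap \overline{p \cdot E(R)} = \{p\}.$$ Furthermore: (1) If $L'$ is any minimal left ideal of $\beta S$, then $L' \cap \overline{p \cdot E(R)} = \{p \cdot e\}$, where $e$ is the (unique) idempotent contained in $L' \cap R$. In particular, $\overline{p \cdot E(R)}$ meets every minimal left ideal in exactly one point. (2) $\{q \cdot E(R) : q \in L \cap R\}$ is a partition of $R$ into relatively closed sets (i.e. sets closed in $R$), and $$\{q \cdot E(R') : R' \text{ is a minimal right ideal of } \beta S \text{ and } q \in L \cap R'\}$$ is a partition of $K(\beta S)$ into relatively closed sets (i.e. sets closed in $K(\beta S)$).
   Context: $\beta S$ is the set of ultrafilters on $S$ (principal ultrafilters identified with points of $S$), with the topology whose basic clopen sets are $\overline{A}=\{p\in\beta S: A\in p\}$ for $A\subseteq S$; closures $\overline{X}$ of subsets $X\subseteq\beta S$ are taken in $\beta S$. The operation of $S$ extends to $\beta S$ by: $A\in p\cdot q$ iff $\{x\in S: x^{-1}A\in q\}\in p$, where $x^{-1}A=\{y\in S: x\cdot y\in A\}$. This makes $\beta S$ a compact Hausdorff right topological semigroup (each map $q\mapsto q\cdot p$ is continuous). $K(\beta S)$ is its smallest two-sided ideal; it is the disjoint union of all minimal left ideals and also the disjoint union of all minimal right ideals. If $L$ is a minimal left ideal and $R$ a minimal right ideal, then $L\cap R$ is a group containing exactly one idempotent. $E(R)$ is the set of idempotents in $R$, and $p\cdot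 E(R)=\{p\cdot e: e\in E(R)\}$. *)

(* Defs.v *)
From HB Require Import structures.
From mathcomp Require Import all_boot.
From mathcomp Require Import all_classical.
From mathcomp Require Import topology.

Set Implicit Arguments.
Unset Strict Implicit.
Unset Printing Implicit Defensive.

Local Open Scope classical_set_scope.
Local Open Scope group_scope.

Record beta (S : Type) := Beta {
  beta_sets : set_system S;
  beta_ultra : UltraFilter beta_sets }.

#[global] Existing Instance beta_ultra.

Lemma beta_eq (S : Type) (p q : beta S) :
  beta_sets p = beta_sets q -> p = q.
Proof.
case: p q => [P uP] [Q uQ] /= PQ; subst Q.
by congr Beta; exact: Prop_irrelevance.
Qed.

HB.instance Definition _ (S : Type) := gen_eqMixin (beta S).
HB.instance Definition _ (S : Type) := gen_choiceMixin (beta S).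

Definition beta_base (S : Type) (A : set S) : set (beta S) :=
  [set p : beta S | beta_sets p A].

Lemma beta_base_cover (S : Type) :
  \bigcup_(A in [set: set S]) beta_base A = [set: beta S].
Proof. by rewrite -subTset => p _; exists setT => //; exact: filterT. Qed.

Lemma beta_base_join (S : Type) (A B : set S) (p : beta S) :
  setT A -> setT B -> beta_base A p -> beta_base B p ->
  exists C, [/\ setT C, beta_base C p &
                beta_base C `<=` beta_base A `&` beta_base B].
Proof.
move=> _ _ pA pB; exists (A `&` B); split => //; first exact: filterI.
by move=> q qAB; split; apply: filterS qAB => x [].
Qed.

HB.instance Definition _ (S : Type) :=
  isBaseTopological.Build (beta S) (@beta_base_cover S) (@beta_base_join S).

Definition beta_mul_sets (S : semigroupType) (p q : beta S) : set_system S :=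
  [set A | beta_sets p [set x | beta_sets q [set y | A (x * y)]]].

Lemma ultra_of_setC (T : Type) (F : set_system T) :
  ProperFilter F -> (forall A, F A \/ F (~` A)) -> UltraFilter F.
Proof.
move=> FF FC; split => // G GF FG; apply/seteqP; split => [A GA|]; last exact: FG.
case: (FC A) => // /FG GCA.
have : G (A `&` ~` A) by exact: filterI.
by rewrite setICr => /filter_not_empty.
Qed.

Lemma beta_mul_ultra (S : semigroupType) (p q : beta S) :
  UltraFilter (beta_mul_sets p q).
Proof.
apply: ultra_of_setC => [|A].
  have pF := @ultra_proper _ _ (beta_ultra p).
  have qF := @ultra_proper _ _ (beta_ultra q).
  split; last split.
  - rewrite /beta_mul_sets /= => H.
    apply: (@filter_not_empty _ (beta_sets p) pF).
    by apply: filterS H => x /(@filter_not_empty _ (beta_sets q) qF).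
  - rewrite /beta_mul_sets /=; apply: filterS filterT => x _ /=.
    by apply: filterS filterT => y.
  - move=> A B; rewrite /beta_mul_sets /=.
    by apply: filterS2 => x /= qA qB; exact: filterI.
  - move=> A B AB; rewrite /beta_mul_sets /=.
    by apply: filterS => x /=; apply: filterS => y; exact: AB.
have [H|H] := in_ultra_setVsetC [set x | beta_sets q [set y | A (x * y)]] (beta_ultra p).
  by left.
right; rewrite /beta_mul_sets /=; apply: filterS H => x /= nq.
by have [/nq|] := in_ultra_setVsetC [set y | A (x * y)] (beta_ultra q).
Qed.

Definition beta_mul (S : semigroupType) (p q : beta S) : beta S :=
  Beta (beta_mul_ultra p q).

Lemma beta_mulA (S : semigroupType) : associative (@beta_mul S).
Proof.
move=> p q r; apply: beta_eq; apply/funext => A /=; rewrite /beta_mul_sets /=.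
congr (beta_sets p _); apply/funext => x /=; congr (beta_sets q _).
apply/funext => y /=; congr (beta_sets r _); apply/funext => z /=.
by rewrite mulgA.
Qed.

HB.instance Definition _ (S : semigroupType) :=
  isSemigroup.Build (beta S) (@beta_mulA S).

Definition left_ideal (T : semigroupType) (I : set T) : Prop :=
  I !=set0 /\ forall x y, I y -> I (x * y).

Definition right_ideal (T : semigroupType) (I : set T) : Prop :=
  I !=set0 /\ forall x y, I x -> I (x * y).

Definition two_sided_ideal (T : semigroupType) (I : set T) : Prop :=
  left_ideal I /\ right_ideal I.

Definition minimal_left_ideal (T : semigroupType) (L : set T) : Prop :=
  left_ideal L /\ forall I, left_ideal I -> I `<=` L -> I = L.

Definition minimal_right_ideal (T : semigroupType) (R : set T) : Prop :=
  right_ideal R /\ forall I, right_ideal I -> I `<=` R -> I = R.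

(* For an arbitrary semigroup this intersection may be empty; it is the
   smallest two-sided ideal whenever one exists, as is the case in [beta S]. *)
Definition smallest_ideal (T : semigroupType) : set T :=
  \bigcap_(I in @two_sided_ideal T) I.
Arguments smallest_ideal T : clear implicits.

Definition idempotents (T : semigroupType) (A : set T) : set T :=
  [set e | A e /\ e * e = e].

Definition translate (T : semigroupType) (p : T) (A : set T) : set T :=
  [set p * a | a in A].

(* [subspace A] makes the points outside [A] isolated, so for [X `<=` A] this
   says that [X] is closed in [A]. The first conjunct forces [X `<=` A]. *)
Definition relatively_closed_partition (T : topologicalType)
    (P : set (set T)) (A : set T) : Prop :=
  partition P id A /\ forall X, P X -> closed (X : set (subspace A)).

(* Main.v *)
Require Import Defs.
From mathcomp Require Import all_boot.
From mathcomp Require Import all_classical.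
From mathcomp Require Import topology.

Local Open Scope classical_set_scope.
Local Open Scope group_scope.

(** An idempotent [e] of a minimal right ideal [R] is a left identity of [R],
    and an idempotent of a minimal left ideal [L'] is a right identity of [L'].
    Hence, for [e] the idempotent of [L' `&` R], right translation by [e]
    sends every point [p * f] of [translate p (idempotents R)] to
    [p * (f * e) = p * e], while it fixes every point of [L'].  The fibres of
    [x |-> x * e] are closed in [beta S], so the whole closure of
    [translate p (idempotents R)] is sent to [p * e], and a point of the
    closure lying in [L'] must be [p * e] itself.

    The partitions come from the same translation.  If [e] is the idempotent of
    [L `&` R] and [q] is in [L `&` R], then [translate q (idempotents R)] is
    exactly the fibre over [q] of the map [x |-> x * e] from [R] to [L `&` R]
    ([translate_idempotentsE]); distinct fibres are disjoint and each is
    relatively closed.  Since the minimal right ideals are pairwise disjoint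
    with union the smallest ideal, and since [x * e] lies in the same minimal
    right ideal as [x], these sets are fibres of [x |-> x * e] on the smallest
    ideal as well ([translate_idempotents_smallestE]).

    The structure theory behind this is purely algebraic.  Once a minimal left
    and a minimal right ideal are given, minimality alone makes the products
    [r * l] with [r] in [R] and [l] in [L] into a group, whose identity is the
    idempotent of [L `&` R] ([idempotents_minimal_meet]).  Topology enters only
    through the closed fibres ([beta_mulr_fiber_closed]). *)

(** * Minimal one-sided ideals of a semigroup *)

Section MinimalIdeals.
Variable T : semigroupType.
Implicit Types (L R : set T) (a e p q x : T).

Lemma minimal_left_factor L a x :
  minimal_left_ideal L -> L a -> L x -> exists2 y, L y & x = y * a.
Proof.
move=> [[L0 Lm] Lmin] La Lx.
suff E : [set y * a | y in L] = L.
  have [y Ly <-] : [set y * a | y in L] x by rewrite E.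
  by exists y.
apply: Lmin.
  split; first by exists (a * a), a.
  by move=> z _ [y Ly <-]; exists (z * y); [exact: Lm|rewrite mulgA].
by move=> _ [y Ly <-]; exact: Lm.
Qed.

Lemma minimal_right_factor R a x :
  minimal_right_ideal R -> R a -> R x -> exists2 y, R y & x = a * y.
Proof.
move=> [[R0 Rm] Rmin] Ra Rx.
suff E : [set a * y | y in R] = R.
  have [y Ry <-] : [set a * y | y in R] x by rewrite E.
  by exists y.
apply: Rmin.
  split; first by exists (a * a), a.
  by move=> _ z [y Ry <-]; exists (y * z); [exact: Rm|rewrite mulgA].
by move=> _ [y Ry <-]; exact: Rm.
Qed.

Lemma minimal_left_idempotent L e x :
  minimal_left_ideal L -> idempotents L e -> L x -> x * e = x.
Proof.
move=> hL [Le ee] Lx.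
have [y _ ->] := minimal_left_factor L e x hL Le Lx.
by rewrite -mulgA ee.
Qed.

Lemma minimal_right_idempotent R e x :
  minimal_right_ideal R -> idempotents R e -> R x -> e * x = x.
Proof.
move=> hR [Re ee] Rx.
have [y _ ->] := minimal_right_factor R e x hR Re Rx.
by rewrite mulgA ee.
Qed.

(** Existence: every [a] in the set [H] of products [r * l] satisfies
    [a H = H = H a], so [a = u * a] for some [u] in [H], and writing any other
    element as [a * c] shows that [u] is a left identity of [H].  Uniqueness:
    two idempotents [e], [f] satisfy [f = e * f = e], as [e] is a left identity
    of [R] and [f] a right identity of [L]. *)
Lemma idempotents_minimal_meet L R :
  minimal_left_ideal L -> minimal_right_ideal R ->
  exists e, idempotents (L `&` R) = [set e].
Proof.
move=> hL hR.
have [[[l0 Ll0] Lm] _] := hL.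
have [[[r0 Rr0] Rm] _] := hR.
have La : L (r0 * l0) by exact: Lm.
have Ra : R (r0 * l0) by exact: Rm.
have [l Ll El] := minimal_left_factor L _ _ hL La Ll0.
set u := r0 * l.
have ua : u * (r0 * l0) = r0 * l0 by rewrite /u -mulgA -El.
have [r Rr Er] := minimal_right_factor R _ _ hR Ra Rr0.
have uu : u * u = u.
  have uE : u = (r0 * l0) * (r * l) by rewrite [RHS]mulgA -Er.
  by rewrite {2}uE mulgA ua -uE.
have [Lu Ru] : L u /\ R u by split; [exact: Lm|exact: Rm].
exists u; apply/seteqP; split => [f [[Lf Rf] ff]|_ ->]; last by [].
rewrite /= -(minimal_right_idempotent R u f hR) //.
by rewrite (minimal_left_idempotent L f u hL).
Qed.

(** A left ideal [I] inside [L * x] pulls back along [y |-> y * x] to a left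
    ideal inside [L], which is all of [L] by minimality. *)
Lemma minimal_left_translate L x :
  minimal_left_ideal L -> minimal_left_ideal [set y * x | y in L].
Proof.
move=> [[[l Ll] Lm] Lmin]; split.
  split; first by exists (l * x), l.
  by move=> z _ [y Ly <-]; exists (z * y); [exact: Lm|rewrite mulgA].
move=> I [[i Ii] Im] IL; apply/seteqP; split=> // _ [y Ly <-].
suff E : L `&` [set y | I (y * x)] = L.
  have [] : (L `&` [set y | I (y * x)]) y by rewrite E.
  by [].
apply: Lmin => [|? []//]; split.
  by have [k Lk Ek] := IL _ Ii; exists k; split => //=; rewrite Ek.
by move=> a b [Lb /= Ib]; split; [exact: Lm|rewrite /= -mulgA; exact: Im].
Qed.

Lemma minimal_right_translate R x :
  minimal_right_ideal R -> minimal_right_ideal [set x * y | y in R].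
Proof.
move=> [[[r Rr] Rm] Rmin]; split.
  split; first by exists (x * r), r.
  by move=> _ z [y Ry <-]; exists (y * z); [exact: Rm|rewrite mulgA].
move=> I [[i Ii] Im] IR; apply/seteqP; split=> // _ [y Ry <-].
suff E : R `&` [set y | I (x * y)] = R.
  have [] : (R `&` [set y | I (x * y)]) y by rewrite E.
  by [].
apply: Rmin => [|? []//]; split.
  by have [k Rk Ek] := IR _ Ii; exists k; split => //=; rewrite Ek.
by move=> a b [Rb /= Ib]; split; [exact: Rm|rewrite /= mulgA; exact: Im].
Qed.

Lemma minimal_right_eq R R' x :
  minimal_right_ideal R -> minimal_right_ideal R' -> R x -> R' x -> R = R'.
Proof.
move=> [[_ Rm] Rmin] [[_ Rm'] Rmin'] Rx Rx'.
have hI : right_ideal (R `&` R').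
  split; first by exists x.
  by move=> a b [Ra Ra']; split; [exact: Rm|exact: Rm'].
exact: etrans (esym (Rmin _ hI (@subIsetl _ _ _))) (Rmin' _ hI (@subIsetr _ _ _)).
Qed.

(** Given one minimal right ideal [R], its left translates [x * R] are again
    minimal right ideals, so the union of all of them is a two-sided ideal.
    Conversely a minimal right ideal meets every two-sided ideal in a right
    ideal and is thus contained in it. *)
Lemma smallest_idealE R : minimal_right_ideal R ->
  smallest_ideal T = \bigcup_(R' in @minimal_right_ideal T) R'.
Proof.
move=> hR; apply/seteqP; split.
  apply: bigcap_inf; have [[[r Rr] _] _] := hR.
  split; split; try by exists r, R.
    move=> x y [R' hR' R'y]; exists [set x * z | z in R'].
      exact: minimal_right_translate.
    by exists y.
  by move=> x y [R' hR' R'x]; exists R' => //; case: hR' => -[_ +] _; apply.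
move=> x [R' [[[r Rr] Rm] Rmin] Rx] I [[[i Ii] Iml] [_ Imr]].
suff E : R' `&` I = R'.
  have [] : (R' `&` I) x by rewrite E.
  by [].
apply: Rmin => [|? []//]; split.
  by exists (r * i); split; [exact: Rm|exact: Iml].
by move=> a b [Ra Ia]; split; [exact: Rm|exact: Imr].
Qed.

(** The inclusion from right to left needs, for [x] in [R], an idempotent [f]
    of [R] with [x * f = x]: as [x = e * x] lies in the minimal left ideal
    [L * x], the idempotent of [(L * x) `&` R] is one, and then
    [x = x * (e * f) = q * f]. *)
Lemma translate_idempotentsE L R e q :
  minimal_left_ideal L -> minimal_right_ideal R -> idempotents (L `&` R) e ->
  (L `&` R) q ->
  translate q (idempotents R) = R `&` [set x | x * e = q].
Proof.
move=> hL hR [[Le Re] ee] [Lq Rq]; have [[_ Rm] _] := hR.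
apply/seteqP; split => [_ [f Ef <-]|x [Rx /= xe]].
  split; first exact: Rm.
  rewrite /= -mulgA (minimal_right_idempotent R f e hR Ef Re).
  exact: (minimal_left_idempotent L e q hL).
have hLx := minimal_left_translate L x hL.
have [f fE] := idempotents_minimal_meet _ _ hLx hR.
have [[Lxf Rf] ff] : idempotents ([set y * x | y in L] `&` R) f by rewrite fE.
exists f => //; rewrite -xe -mulgA (minimal_right_idempotent R e f hR) //.
apply: (minimal_left_idempotent _ f x hLx) => //.
by exists e => //; exact: (minimal_right_idempotent R).
Qed.

(** [x * e] lies in the minimal right ideal [R'] containing [x]; if it equals
    [q], an element of [R], then [R' = R]. *)
Lemma translate_idempotents_smallestE L R e q :
  minimal_left_ideal L -> minimal_right_ideal R -> idempotents (L `&` R) e ->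
  (L `&` R) q ->
  translate q (idempotents R) = smallest_ideal T `&` [set x | x * e = q].
Proof.
move=> hL hR he hq; rewrite (translate_idempotentsE L R e q) //.
rewrite (smallest_idealE R hR).
apply/seteqP; split => [x [Rx xe]|x [[R' hR' R'x] /= xe]].
  by split => //; exists R.
split=> //; rewrite (minimal_right_eq R R' q) //; first by case: hq.
by rewrite -xe; case: hR' => -[_ +] _; apply.
Qed.

End MinimalIdeals.

(** * Closed fibres of right translations of the ultrafilter semigroup *)

Lemma beta_base_nbhs (S : Type) (A : set S) (x : beta S) :
  beta_base A x -> nbhs x (beta_base A).
Proof.
move=> xA; apply: open_nbhs_nbhs; split => //.
by exists [set A] => //; rewrite bigcup_set1.
Qed.

(** If [x] is in the closure of the fibre over [q] and [A] is a member of
    [x * e], the basic neighbourhood of [x] given by the [s] with [s^-1 A] in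
    [e] contains a point [y] of the fibre, whence [A] is a member of
    [y * e = q].  So [x * e] is included in [q], and ultrafilters are
    maximal. *)
Lemma beta_mulr_fiber_closed (S : semigroupType) (e q : beta S) :
  closed [set x | x * e = q].
Proof.
move=> x clx /=; apply: beta_eq; symmetry.
apply: (max_filter (F := beta_sets (x * e))).
move=> A xeA.
have [y [ye yA]] := clx _ (beta_base_nbhs _ _ x xeA).
by rewrite -ye.
Qed.

Lemma minimal_left_meet_closure (S : semigroupType) (L R : set (beta S))
    (p e : beta S) :
  minimal_left_ideal L -> minimal_right_ideal R -> idempotents (L `&` R) e ->
  L `&` closure (translate p (idempotents R)) = [set p * e].
Proof.
move=> hL hR [[Le Re] ee]; apply/seteqP; split => [x [Lx clx]|_ ->].
  rewrite /= -[LHS](minimal_left_idempotent _ L e x hL) //.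
  apply: (beta_mulr_fiber_closed S e (p * e)).
  apply: closureS clx => _ [f Ef <-] /=.
  by rewrite -mulgA (minimal_right_idempotent _ R f e hR Ef Re).
split; first by case: hL => -[_ +] _; apply.
by apply: subset_closure; exists e.
Qed.

Theorem theorem2p1 (S : semigroupType) (S_infinite : infinite_set [set: S])
    (L R : set (beta S)) (hL : minimal_left_ideal L)
    (hR : minimal_right_ideal R) (p : beta S) (hp : (L `&` R) p) :
  [/\ L `&` closure (translate p (idempotents R)) = [set p],
      (forall L' : set (beta S), minimal_left_ideal L' ->
         exists e : beta S, idempotents (L' `&` R) = [set e] /\
           L' `&` closure (translate p (idempotents R)) = [set p * e]) /\
      (forall L' : set (beta S), minimal_left_ideal L' ->
         exists! x : beta S, (L' `&` closure (translate p (idempotents R))) x),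
      relatively_closed_partition
        [set translate q (idempotents R) | q in L `&` R] R
    & relatively_closed_partition
        [set X | exists (R' : set (beta S)) (q : beta S),
           [/\ minimal_right_ideal R', (L `&` R') q
             & X = translate q (idempotents R')]]
        (smallest_ideal (beta S))].
Proof.
have meet (L' : set (beta S)) : minimal_left_ideal L' ->
    exists e, idempotents (L' `&` R) = [set e] /\
      L' `&` closure (translate p (idempotents R)) = [set p * e].
  move=> hL'; have [e eE] := idempotents_minimal_meet _ L' R hL' hR.
  by exists e; split => //; apply: minimal_left_meet_closure; rewrite // eE.
have idem (R' : set (beta S)) : minimal_right_ideal R' ->
    exists e, idempotents (L `&` R') e.
  move=> hR'; have [e eE] := idempotents_minimal_meet _ L R' hL hR'.
  by exists e; rewrite eE.
have memLR (R' : set (beta S)) e x : minimal_right_ideal R' ->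
    idempotents (L `&` R') e -> R' x -> (L `&` R') (x * e).
  move=> [[_ Rm'] _] [[Le _] _] Rx; split; last exact: Rm'.
  by case: hL => -[_ +] _; apply.
have ne (R' : set (beta S)) q : minimal_right_ideal R' ->
    translate q (idempotents R') !=set0.
  by move=> /idem[e [[_ Re] ee]]; exists (q * e), e.
split.
- have [e he] := idem R hR.
  rewrite (minimal_left_meet_closure _ L R p e) //.
  case: he hp => -[Le _] ee [Lp _].
  by rewrite (minimal_left_idempotent _ L e p).
- split=> // L' /meet[e [_ ->]].
  by exists (p * e); split => // x ->.
- have [e he] := idem R hR.
  have fE q (hq : (L `&` R) q) := translate_idempotentsE _ L R e q hL hR he hq.
  split; first split.
  + apply/seteqP; split => [x [_ [q hq <-]]|x Rx]; first by rewrite fE// => -[].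
    have hq := memLR R e x hR he Rx.
    by exists (translate (x * e) (idempotents R)); [exists (x * e)|rewrite fE].
  + move=> _ _ [q hq <-] [q' hq' <-] [x []].
    by rewrite /= !fE // => -[_ <-] [_ <-].
  + by move=> _ [q hq <-]; exact: ne.
  + move=> _ [q hq <-]; rewrite fE //; apply/closed_subspaceP.
    exists [set x | x * e = q]; first exact: beta_mulr_fiber_closed.
    by rewrite [R `&` _]setIC -setIA setIid.
- have KE := smallest_idealE _ R hR.
  split; first split.
  + apply/seteqP; split => [x [_ [R' [q [hR' hq ->]]]]|x].
      have [e he] := idem R' hR'.
      by rewrite (translate_idempotents_smallestE _ L R' e q) // => -[].
    rewrite {1}KE => -[R' hR' R'x]; have [e he] := idem R' hR'.
    have hq := memLR R' e x hR' he R'x.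
    exists (translate (x * e) (idempotents R')); first by exists R', (x * e).
    by rewrite /= (translate_idempotentsE _ L R' e).
  + move=> _ _ [R1 [q1 [hR1 hq1 ->]]] [R2 [q2 [hR2 hq2 ->]]] [x [/= X1 X2]].
    have sub R' q : minimal_right_ideal R' -> (L `&` R') q ->
        translate q (idempotents R') `<=` R'.
      by move=> [[_ Rm'] _] [_ R'q] _ [f _ <-]; exact: Rm'.
    have R12 := minimal_right_eq _ R1 R2 x hR1 hR2
      (sub _ _ hR1 hq1 _ X1) (sub _ _ hR2 hq2 _ X2).
    subst R2; have [e he] := idem R1 hR1.
    have fE q (hq : (L `&` R1) q) :=
      translate_idempotentsE _ L R1 e q hL hR1 he hq.
    have [_ <-] : (R1 `&` [set x | x * e = q1]) x by rewrite -fE.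
    by have [_ <-] : (R1 `&` [set x | x * e = q2]) x by rewrite -fE.
  + by move=> _ [R' [q [hR' hq ->]]]; exact: ne.
  + move=> _ [R' [q [hR' hq ->]]]; have [e he] := idem R' hR'.
    rewrite (translate_idempotents_smallestE _ L R' e q) //.
    apply/closed_subspaceP.
    exists [set x | x * e = q]; first exact: beta_mulr_fiber_closed.
    by rewrite [smallest_ideal _ `&` _]setIC -setIA setIid.
Qed.
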